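(* For all integers $n \ge 0$ and $k \ge 2$, the following hold: (a) $b_{k,0}(n)=c_{k,0}(n)$ and $b_{k,1}(n)=c_{k,1}(n)$; (b) $a_k(n) = b_{k,1}(n)-(k-1)\,b_{k,0}(n) = c_{k,1}(n)-(k-1)\,c_{k,0}(n)$.
   Context: A partition $\lambda$ of $n\ge 0$ is written $\lambda = (\lambda_1^{m_1}, \ldots, \lambda_\ell^{m_\ell})$ with distinct positive integers $\lambda_i$ (the parts), multiplicities (exponents) $m_i \ge 1$, and $n=\sum_{i=1}^\ell m_i\lambda_i$; partitions are considered up to reordering. Let $k\ge 2$. - $a_k(n)$ is the total number of parts divisible by $k$, counted with multiplicity, in all partitions of $n$ in which every part has multiplicity strictly less than $k$. (That is, the sum over all partitions of $n$ with all $m_i<k$ of $\sum_{i:\,k\mid\lambda_i} m_i$.) - $b_{k,0}(n)$ (respectively $b_{k,1}(n)$) is the number of partitions $\lambda = (\lambda_1^{m_1}, \ldots, \lambda_\ell^{m_\ell})$ of $n$ such that exactly one $\lambda_i$ is divisible by $k$, and the corresponding exponent $m_i$ is divisible by $k$ (respectively not divisible by $k$). - $c_{k,0}(n)$ (respectively $c_{k,1}(n)$) is the number of partitions $\lambda = (\lambda_1^{m_1}, \ldots, \lambda_\ell^{m_\ell})$ of $n$ such that exactly one index $i$ has $m_i\ge k$, and the corresponding $\lambda_i$ is divisible by $k$ (respectively not divisible by $k$). *)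

(* Defs.v *)
From mathcomp Require Import all_boot.

Set Implicit Arguments.
Unset Strict Implicit.
Unset Printing Implicit Defensive.

(* A partition of n, taken up to reordering, is encoded by its multiplicities:
   [m i] is the number of times the positive integer [i.+1] occurs as a part.
   Parts and multiplicities of a partition of n are at most n, so 'I_n and
   'I_n.+1 lose nothing; for n = 0 there is exactly one, empty, partition. *)
Definition mults (n : nat) := {ffun 'I_n -> 'I_n.+1}.

Definition partitions (n : nat) : {set mults n} :=
  [set m : mults n | \sum_(i < n) m i * i.+1 == n].

Definition parts (n : nat) (m : mults n) : {set 'I_n} := [set i | 0 < m i].

Definition a (k n : nat) : nat :=
  \sum_(m : mults n | (m \in partitions n) && [forall i in parts m, m i < k])
    \sum_(i in parts m | k %| i.+1) m i.

(* In b0, b1, c0 and c1, "exactly one index i satisfies P" is rendered as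
   "the set of indices satisfying P is a singleton [set i]". *)
Definition b0 (k n : nat) : nat :=
  #|[set m : mults n in partitions n |
      [exists i, ([set j in parts m | k %| j.+1] == [set i]) && (k %| m i)]]|.

Definition b1 (k n : nat) : nat :=
  #|[set m : mults n in partitions n |
      [exists i, ([set j in parts m | k %| j.+1] == [set i]) && ~~ (k %| m i)]]|.

Definition c0 (k n : nat) : nat :=
  #|[set m : mults n in partitions n |
      [exists i, ([set j in parts m | k <= m j] == [set i]) && (k %| i.+1)]]|.

Definition c1 (k n : nat) : nat :=
  #|[set m : mults n in partitions n |
      [exists i, ([set j in parts m | k <= m j] == [set i]) && ~~ (k %| i.+1)]]|.

(* Main.v *)
Require Import Defs.
From mathcomp Require Import all_boot all_algebra.
From mathcomp Require Import ring zify.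

Import GRing.Theory Num.Theory.

(** All five counts are compared through their generating functions.  Write
    G(y) = 1 / (1 - y), and let Phi be the generating function of the
    partitions in which every part occurs fewer than k times,

      Phi = prod_(j >= 1) (1 - x^(kj)) / (1 - x^j).

    Cancelling the numerators against the denominators with index divisible by
    k shows that Phi also counts the partitions having no part divisible by k:
    this is Glaisher's theorem ([glaisher_few]).

    Each of the counts singles out one part i and lets it contribute through
    its multiplicity, while all other parts obey a fixed restriction; their
    series is Phi times a sum over i ([series_single_out]), namely
    - for b_(k,0): the sum over k | i of G(x^(ki)) - 1,
      and for b_(k,0) + b_(k,1): the sum over k | i of G(x^i) - 1;
    - for c_(k,0) and c_(k,1): the sums over k | i and over the other i of
      G(x^(ki)) - 1, because y^k G(y) = D(y) (G(y^k) - 1), where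
      D(y) = (1 - y^k) G(y) is the contribution of a part used fewer than k
      times;
    - for a_k: the sum over k | i of (G(x^i) - 1) - k (G(x^(ki)) - 1), which is
      the logarithmic derivative y D'(y) / D(y) at y = x^i.
    So b_(k,0) and c_(k,0) have the same series.  For b_(k,1) and c_(k,1), the
    sum of G(x^i) - 1 over the multiples i of k is the sum of G(x^(ki)) - 1
    over all i ([sum_dilated]); removing the terms G(x^(ki)) - 1 with k | i
    from both sides leaves the two series.  The formula for a_k is read off
    termwise as a_k = (b_(k,0) + b_(k,1)) - k b_(k,0).

    Only coefficients up to x^n matter, so the computation takes place in an
    arbitrary commutative ring with an element x such that x^(n+1) = 0, where
    the infinite series above are finite sums; the truncated polynomial ring
    Z[X]/(X^(n+1)) then gives back the coefficients ([sum_partitions_eq]). *)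

Section GeneratingFunctions.

Set Implicit Arguments.
Unset Strict Implicit.
Local Open Scope ring_scope.

(** * Series over partitions in a nilpotent variable *)

Definition weight n (m : mults n) : nat := (\sum_(i < n) m i * i.+1)%N.

Definition series n (A : comNzRingType) (x : A) (F : mults n -> nat) : A :=
  \sum_(m : mults n) (F m)%:R * x ^+ weight m.

(** Taking for x the class of 'X in Z[X]/('X^(n+1)), where the coefficient of
    'X^n can be read off, turns identities between series into identities
    between sums over the partitions of n. *)
Lemma sum_partitions_eq n (F G : mults n -> nat) :
  (forall (A : comNzRingType) (x : A), (x ^+ n.+1 = 0) ->
     series x F = series x G) ->
  (\sum_(m in partitions n) F m = \sum_(m in partitions n) G m)%N.
Proof.
move=> eqFG; pose h : {poly int} := 'X^(n.+1).
have hE : mk_monic h = h by rewrite mk_monic_Xn.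
have coefE (H : mults n -> nat) :
    (in_qpoly h (\sum_(m : mults n) (H m)%:R * 'X^(weight m)) : {poly int})`_n
    = (\sum_(m in partitions n) H m)%N%:R.
  set p := (\sum_(m : mults n) _).
  have -> : (in_qpoly h p : {poly int})`_n = p`_n.
    rewrite [p in RHS](Pdiv.RingMonic.rdivp_eq (monicXn _ n.+1) p) coefD.
    by rewrite coefMXn ltnSn add0r /= hE.
  rewrite coef_sum natr_sum [RHS]big_mkcond; apply: eq_bigr => m _.
  rewrite mulr_natl coefMn coefXn inE -/(weight m) eq_sym.
  by case: eqP; rewrite ?mul0rn ?pmulrn.
have qX0 : (in_qpoly h 'X ^+ n.+1 = 0).
  rewrite -rmorphXn; apply/val_inj; rewrite /= hE.
  by rewrite Pdiv.RingMonic.rmodpp ?monicXn.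
have mapE (H : mults n -> nat) :
    series (in_qpoly h 'X) H
    = in_qpoly h (\sum_(m : mults n) (H m)%:R * 'X^(weight m)).
  rewrite rmorph_sum; apply: eq_bigr => m _.
  by rewrite rmorphM rmorph_nat rmorphXn.
have := eqFG _ _ qX0; rewrite !mapE.
move=> /(congr1 (fun q : {poly %/ h} => (q : {poly int})`_n)).
by rewrite !coefE => /eqP; rewrite eqr_nat => /eqP.
Qed.

(** The shape shared by all the counts.  Both weights take the size of a part
    first and its multiplicity second. *)
Definition single_out n (s o : nat -> nat -> nat) (m : mults n) : nat :=
  (\sum_(i < n) s i.+1 (m i) * \prod_(j < n | j != i) o j.+1 (m j))%N.

(** The Euler factor, at y = x^i, of a part of size i whose multiplicity r is
    weighted by [f r]. *)
Definition local_factor n (A : comNzRingType) (y : A) (f : nat -> nat) : A :=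
  \sum_(r < n.+1) (f r)%:R * y ^+ r.

(** Expanding the product of the Euler factors gives the series for each choice
    of the distinguished part; when the factor of that part is [v] times the
    ordinary one, the product of ordinary factors no longer depends on
    the choice and can be taken out of the sum. *)
Lemma series_single_out n (A : comNzRingType) (x : A) s o (v : nat -> A) :
  (forall i, (0 < i)%N -> local_factor n (x ^+ i) (s i)
      = local_factor n (x ^+ i) (o i) * v i) ->
  series x (@single_out n s o)
  = (\prod_(j < n) local_factor n (x ^+ j.+1) (o j.+1)) * \sum_(i < n) v i.+1.
Proof.
move=> sE; rewrite /series.
under eq_bigr do rewrite natr_sum mulr_suml.
rewrite exchange_big mulr_sumr; apply: eq_bigr => i _ /=.
pose f (j : 'I_n) (r : nat) : A :=
  (if j == i then s j.+1 r else o j.+1 r)%:R * (x ^+ j.+1) ^+ r.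
transitivity (\sum_(m : mults n) \prod_(j < n) f j (m j)).
  apply: eq_bigr => m _; rewrite big_split /= natrM natr_prod; congr (_ * _).
    rewrite [RHS](bigD1 i) //= eqxx; congr (_ * _).
    by apply: eq_bigr => j /negbTE->.
  rewrite /weight -prodrXr; apply: eq_bigr => j _.
  by rewrite -exprM mulnC.
rewrite -(bigA_distr_bigA (fun j (r : 'I_n.+1) => f j r)).
rewrite (bigD1 i) //= [in RHS](bigD1 i) //= mulrAC.
congr (_ * _).
  by rewrite -sE //; apply: eq_bigr => r _; rewrite /f eqxx.
by apply: eq_bigr => j /negbTE ji; apply: eq_bigr => r _; rewrite /f ji.
Qed.

(** * Euler factors of one part *)

(** The series G(y) of the introduction, all of whose further terms vanish for
    the [y] considered. *)
Definition geom n (A : comNzRingType) (y : A) : A := \sum_(r < n.+1) y ^+ r.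

Lemma geom_mul n (A : comNzRingType) (y : A) :
  y ^+ n.+1 = 0 -> geom n y * (1 - y) = 1.
Proof.
by move=> y0; rewrite mulrC -opprB mulNr -subrX1 y0 sub0r opprK.
Qed.

(** The law is arbitrary because this reindexing is applied to sums of terms
    that vanish beyond n and, in Glaisher's theorem, to a product of factors
    that are 1 beyond n. *)
Lemma big_multiples (A : Type) (idx : A) (op : Monoid.com_law idx)
    (n k : nat) (F : nat -> A) : (0 < k)%N ->
  (forall i, (n < i)%N -> F i = idx) ->
  \big[op/idx]_(i < n) F (k * i.+1)%N = \big[op/idx]_(i < n | (k %| i.+1)%N) F i.+1.
Proof.
move=> k0 F0.
transitivity (\big[op/idx]_(i < n * k | (k %| i.+1)%N) F i.+1).
  (* Each block of k consecutive indices contains one multiple, its last. *)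
  elim: n {F0} => [|n IHn]; first by rewrite mul0n !big_ord0.
  rewrite big_ord_recr IHn mulSn addnC big_split_ord /=; congr (op _ _).
  case: k k0 {IHn} => // k _; rewrite big_mkcond big_ord_recr /=.
  rewrite big1 => [|i _].
    by rewrite Monoid.mul1m -addnS -mulSnr dvdn_mull // mulnC.
  by rewrite -addnS dvdn_addr ?dvdn_mull // gtnNdvd // ltnS.
have le_n : (n <= n * k)%N by rewrite leq_pmulr.
rewrite (big_ord_widen_cond _ (fun i => k %| i.+1)%N (fun i => F i.+1) le_n).
rewrite big_mkcond [RHS]big_mkcond; apply: eq_bigr => i _.
by case: ltnP => // ni; rewrite ?andbT ?andbF // F0 // if_same.
Qed.

(** The truncation of multiplicities at n is invisible, whether k exceeds n or
    not, because the powers of y above n vanish. *)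
Lemma local_factor_lt n (A : comNzRingType) (y : A) k (c : nat -> nat) :
  y ^+ n.+1 = 0 ->
  local_factor n y (fun r => if (r < k)%N then c r else 0%N)
  = \sum_(r < k) (c r)%:R * y ^+ r.
Proof.
move=> y0; pose t (r : nat) := (if (r < k)%N then (c r)%:R else 0) * y ^+ r : A.
have widen N : (n < N)%N -> \sum_(r < n.+1) t r = \sum_(r < N) t r.
  move=> nN; rewrite (big_ord_widen N t nN) big_mkcond; apply: eq_bigr => r _.
  case: ltnP => // nr; rewrite /t -(subnK nr) exprD y0.
  by rewrite !mulr0.
transitivity (\sum_(r < n.+1) t r).
  by apply: eq_bigr => r _; rewrite /t; case: ifP.
rewrite (widen (n.+1 + k)%N) ?leq_addr //.
rewrite (big_ord_widen (n.+1 + k) (fun r => (c r)%:R * y ^+ r)) ?leq_addl //.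
rewrite [RHS]big_mkcond; apply: eq_bigr => r _.
by rewrite /t; case: ifP => // _; rewrite mul0r.
Qed.

Lemma geom_low n (A : comNzRingType) (y : A) k :
  y ^+ n.+1 = 0 -> geom n y * (1 - y ^+ k) = \sum_(r < k) y ^+ r.
Proof.
by move=> y0; rewrite -opprB subrX1 -mulNr opprB mulrA (geom_mul y0) mul1r.
Qed.

Lemma local_factor_few n (A : comNzRingType) (y : A) k :
  y ^+ n.+1 = 0 ->
  local_factor n y (fun r => (r < k)%N) = geom n y * (1 - y ^+ k).
Proof.
move=> y0; transitivity (\sum_(r < k) 1%:R * y ^+ r).
  rewrite -(local_factor_lt k (fun=> 1%N) y0); apply: eq_bigr => r _.
  by case: (_ < _)%N.
by rewrite geom_low //; apply: eq_bigr => r _; rewrite mul1r.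
Qed.

Lemma local_factor_some n (A : comNzRingType) (y : A) :
  local_factor n y (fun r => (0 < r)%N) = geom n y - 1.
Proof.
rewrite /local_factor /geom !big_ord_recl /= mul0r add0r expr0 [1 + _]addrC addrK.
by apply: eq_bigr => r _; rewrite mul1r.
Qed.

Lemma local_factor_all n (A : comNzRingType) (y : A) :
  local_factor n y (fun=> 1%N) = geom n y.
Proof. by apply: eq_bigr => r _; rewrite mul1r. Qed.

Lemma local_factor_none n (A : comNzRingType) (y : A) :
  local_factor n y (fun r => ~~ (0 < r)%N) = 1.
Proof.
rewrite /local_factor big_ord_recl /= mul1r big1 ?addr0 // => r _.
by rewrite mul0r.
Qed.

Lemma local_factor_const0 n (A : comNzRingType) (y : A) :
  local_factor n y (fun=> 0%N) = 0.
Proof. by rewrite /local_factor big1 // => r _; rewrite mul0r. Qed.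

Lemma nilpotent_expr n (A : comNzRingType) (x : A) i :
  x ^+ n.+1 = 0 -> (n < i)%N -> x ^+ i = 0.
Proof. by move=> x0 ni; rewrite -(subnK ni) exprD x0 mulr0. Qed.

Lemma nilpotent_exprX n (A : comNzRingType) (y : A) i :
  (0 < i)%N -> y ^+ n.+1 = 0 -> (y ^+ i) ^+ n.+1 = 0.
Proof. by move=> i0 y0; rewrite -exprM (nilpotent_expr y0) // leq_pmull. Qed.

Lemma local_factor_multiple n (A : comNzRingType) (y : A) k :
  (0 < k)%N -> y ^+ n.+1 = 0 ->
  local_factor n y (fun r => (0 < r)%N && (k %| r)%N) = geom n (y ^+ k) - 1.
Proof.
move=> k0 y0.
rewrite /local_factor /geom !big_ord_recl /= mul0r add0r expr0 [1 + _]addrC addrK.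
have /= := @big_multiples A 0 +%R n k (fun i => y ^+ i) k0
  (fun i => nilpotent_expr (i := i) y0).
under eq_bigr do rewrite exprM.
move=> ->; rewrite [RHS]big_mkcond; apply: eq_bigr => r _ /=.
by case: ifP; rewrite ?mul1r ?mul0r.
Qed.

(** Splitting off the multiple of k from a multiplicity r >= k writes it as
    r = ks + r' with s > 0 and r' < k, which gives the factorization. *)
Lemma local_factor_many n (A : comNzRingType) (y : A) k :
  (0 < k)%N -> y ^+ n.+1 = 0 ->
  local_factor n y (fun r => (0 < r)%N && (k <= r)%N)
  = local_factor n y (fun r => ~~ ((0 < r)%N && (k <= r)%N)) * (geom n (y ^+ k) - 1).
Proof.
move=> k0 y0; have yk0 := nilpotent_exprX k0 y0.
have fewE : local_factor n y (fun r => ~~ ((0 < r)%N && (k <= r)%N))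
    = geom n y * (1 - y ^+ k).
  rewrite -local_factor_few //; apply: eq_bigr => r _; congr (_ %:R * _).
  by case: r => -[|r] /= _; rewrite ?k0 // -ltnNge.
have splitE : local_factor n y (fun r => (0 < r)%N && (k <= r)%N)
    = geom n y - local_factor n y (fun r => ~~ ((0 < r)%N && (k <= r)%N)).
  rewrite -[geom n y]local_factor_all /local_factor -sumrB.
  by apply: eq_bigr => r _; case: (_ && _); rewrite /= ?mul0r ?subr0 ?subrr.
have := geom_mul yk0; rewrite splitE fewE; set g := geom n (y ^+ k) => gE.
by rewrite [RHS]mulrBr mulr1 -[_ * _ * g]mulrA [_ * g]mulrC gE mulr1.
Qed.

(** With D = (1 - y^k) / (1 - y) = 1 + y + ... + y^(k-1), the left-hand side is
    y D'(y), and the right-hand side is D times the logarithmic derivative of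
    the quotient. *)
Lemma local_factor_copies n (A : comNzRingType) (y : A) k :
  (0 < k)%N -> y ^+ n.+1 = 0 ->
  local_factor n y (fun r => if (r < k)%N then r else 0%N)
  = local_factor n y (fun r => (r < k)%N)
    * (geom n y - 1 - k%:R * (geom n (y ^+ k) - 1)).
Proof.
move=> k0 y0; have yk0 := nilpotent_exprX k0 y0.
rewrite (local_factor_lt k id y0) local_factor_few //.
(* Multiplying by 1 - y telescopes the coefficients r to 1. *)
have sumE : (\sum_(r < k) r%:R * y ^+ r) * (1 - y)
    = geom n y * (1 - y ^+ k) - 1 - (k%:R - 1) * y ^+ k.
  rewrite geom_low //.
  case: k k0 {yk0} => // k _; elim: k => [|k IHk].
    by rewrite !big_ord1 mul0r; ring.
  rewrite big_ord_recr mulrDl IHk [in RHS]big_ord_recr /=.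
  by rewrite !exprS -!natr1; ring.
have gE := geom_mul y0; have hE := geom_mul yk0.
rewrite -[LHS]mulr1 -[X in _ * X = _]gE [geom n y * (1 - y)]mulrC mulrA sumE.
move: gE hE; set g := geom n y; set h := geom n (y ^+ k); set z := y ^+ k => gE hE.
have hzE : h * z = h - 1 by rewrite -hE; ring.
by ring: hzE.
Qed.

(** * The counts as sums with one part singled out *)

Definition singled_part (Q P : nat -> nat -> bool) (i r : nat) : nat :=
  [&& (0 < r)%N, Q i r & P i r].

Definition other_part (Q : nat -> nat -> bool) (j r : nat) : nat :=
  ~~ ((0 < r)%N && Q j r).

(** At most one part can be the unique one with property [Q], so the indicator
    of the existence of such a part is the sum over all parts of the indicators
    that this one is it; each of those is a product over the parts. *)
Lemma card_exactly_one n (Q P : nat -> nat -> bool) :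
  #|[set m : mults n in partitions n |
      [exists i, ([set j in parts m | Q j.+1 (m j)] == [set i]) && P i.+1 (m i)]]|
  = (\sum_(m in partitions n) single_out (singled_part Q P) (other_part Q) m)%N.
Proof.
rewrite -sum1_card; under eq_bigl do rewrite in_set.
rewrite big_mkcondr; apply: eq_bigr => m _ /=.
set S := [set j in parts m | Q j.+1 (m j)].
(* The i-th term is the indicator that i is the unique part in S. *)
have termE (i : 'I_n) : (singled_part Q P i.+1 (m i)
      * \prod_(j < n | j != i) other_part Q j.+1 (m j))%N
    = (S == [set i]) && P i.+1 (m i).
  have SE j : (j \in S) = (0 < m j)%N && Q j.+1 (m j) by rewrite !inE.
  have -> : (\prod_(j < n | j != i) other_part Q j.+1 (m j))%N
      = [forall j, (j != i) ==> (j \notin S)].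
    case: forallP => [S1|/forallP].
      by rewrite big1 // => j /(implyP (S1 j)); rewrite SE /other_part => ->.
    rewrite negb_forall => /existsP[j]; rewrite negb_imply => /andP[ji].
    by rewrite negbK SE (bigD1 j ji) /= /other_part => ->.
  rewrite mulnb /singled_part andbA -SE; congr nat_of_bool.
  rewrite andbAC; congr andb; apply/andP/eqP => [[iS /forallP S1]|SE1].
    apply/setP => j; rewrite in_set1; case: eqVneq => [->|ji] //.
    by apply/negbTE; have := S1 j; rewrite ji.
  rewrite SE1 set11; split=> //; apply/forallP => j; apply/implyP.
  by rewrite in_set1.
rewrite /single_out; under eq_bigr do rewrite termE.
case: existsP => [[i /andP[/eqP SE Pi]]|noi].
  rewrite (bigD1 i) //= SE eqxx Pi big1 // => j ji.
  by rewrite (inj_eq set1_inj) eq_sym (negbTE ji).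
rewrite big1 // => i _; apply/eqP; rewrite eqb0; apply/negP => Si.
by apply: noi; exists i.
Qed.

Lemma series_linear n (A : comNzRingType) (x : A) (F G : mults n -> nat) c :
  series x (fun m => F m + c * G m)%N = series x F + c%:R * series x G.
Proof.
rewrite /series mulr_sumr -big_split; apply: eq_bigr => m _ /=.
by rewrite natrD natrM mulrDl mulrA.
Qed.

Definition counted_part (k i r : nat) : nat :=
  if (k %| i)%N && (r < k)%N then r else 0%N.

Definition few_copies (k : nat) (_ r : nat) : nat := (r < k)%N.

Lemma a_single_out k n : (0 < k)%N ->
  a k n = (\sum_(m in partitions n) single_out (counted_part k) (few_copies k) m)%N.
Proof.
move=> k0; rewrite /a big_mkcondr; apply: eq_bigr => m _; rewrite /single_out.
case: forall_inP => [ltk|/forall_inP].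
  have m_lt (i : 'I_n) : (m i < k)%N.
    by have := ltk i; rewrite inE; case: (posnP (m i)) => [-> //|_]; apply.
  rewrite big_mkcond; apply: eq_bigr => i _ /=.
  rewrite [X in (_ * X)%N]big1 => [|j _]; last by rewrite /few_copies m_lt.
  rewrite muln1 inE /counted_part m_lt andbT.
  by case: (posnP (m i)) => [->|_] /=; rewrite ?if_same.
rewrite negb_forall => /existsP[j]; rewrite negb_imply -leqNgt => /andP[_ kj].
rewrite big1 // => i _; case: (eqVneq j i) => [<-|ji].
  by rewrite /counted_part ltnNge kj andbF.
by rewrite [X in (_ * X)%N](bigD1 j) //= /few_copies ltnNge kj muln0.
Qed.

(** * The series of the counts *)

(** The series Phi of the partitions whose multiplicities are all below k, in
    the form of a product of quotients. *)
Definition few_series n (A : comNzRingType) (x : A) (k : nat) : A :=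
  \prod_(j < n) (geom n (x ^+ j.+1) * (1 - x ^+ j.+1 ^+ k)).

(** Glaisher's theorem: the factors [1 - x ^+ (k * j)] are the [1 - x ^+ i] with
    i divisible by k, and they cancel the corresponding geometric series. *)
Lemma glaisher_few n (A : comNzRingType) (x : A) k :
  (0 < k)%N -> x ^+ n.+1 = 0 ->
  \prod_(j < n) local_factor n (x ^+ j.+1) (other_part (fun i _ => k %| i)%N j.+1)
  = few_series n x k.
Proof.
move=> k0 x0; rewrite /few_series big_split /=.
under [X in _ = _ * X]eq_bigr => j _ do rewrite -exprM mulnC.
have F1 i : (n < i)%N -> 1 - x ^+ i = 1.
  by move=> ni; rewrite (nilpotent_expr x0 ni) subr0.
rewrite (big_multiples *%R k0 F1).
rewrite [X in _ = _ * X]big_mkcond -big_split; apply: eq_bigr => j _ /=.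
rewrite /other_part; case: ifP => kj.
  rewrite (geom_mul (nilpotent_exprX (ltn0Sn j) x0)).
  rewrite -[RHS](local_factor_none n (x ^+ j.+1)).
  by apply: eq_bigr => r _; rewrite andbT.
rewrite mulr1 -local_factor_all.
by apply: eq_bigr => r _; rewrite andbF.
Qed.

Lemma prod_few_copies n (A : comNzRingType) (x : A) k : x ^+ n.+1 = 0 ->
  \prod_(j < n) local_factor n (x ^+ j.+1) (few_copies k j.+1)
  = few_series n x k.
Proof.
move=> x0; apply: eq_bigr => j _; rewrite -local_factor_few //.
exact: nilpotent_exprX.
Qed.

Lemma other_part_few k : (0 < k)%N ->
  other_part (fun _ r => k <= r)%N =2 few_copies k.
Proof. by move=> k0 j [|r]; rewrite /other_part /few_copies /= ?k0 // -ltnNge. Qed.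

Lemma series_b n (A : comNzRingType) (x : A) k (P : nat -> nat -> bool) (v : nat -> A) :
  (0 < k)%N -> x ^+ n.+1 = 0 ->
  (forall i, (0 < i)%N -> (k %| i)%N ->
     local_factor n (x ^+ i) (fun r => (0 < r)%N && P i r) = v i) ->
  series x (@single_out n (singled_part (fun i _ => k %| i)%N P)
                          (other_part (fun i _ => k %| i)%N))
  = few_series n x k
    * \sum_(i < n | (k %| i.+1)%N) v i.+1.
Proof.
move=> k0 x0 vE.
rewrite (series_single_out (v := fun i => if (k %| i)%N then v i else 0)).
  by rewrite glaisher_few // [X in _ = _ * X]big_mkcond.
move=> i i0; rewrite /singled_part /other_part; case: ifP => ki.
  rewrite -vE // -[LHS]mul1r -(local_factor_none n (x ^+ i)); congr (_ * _).
  by apply: eq_bigr => r _; rewrite andbT.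
rewrite mulr0 -[RHS](local_factor_const0 n (x ^+ i)).
by apply: eq_bigr => r _; rewrite andbF.
Qed.

Lemma series_c n (A : comNzRingType) (x : A) k (P : pred nat) :
  (0 < k)%N -> x ^+ n.+1 = 0 ->
  series x (@single_out n (singled_part (fun _ r => k <= r)%N (fun i _ => P i))
                          (other_part (fun _ r => k <= r)%N))
  = few_series n x k * \sum_(i < n | P i.+1) (geom n (x ^+ i.+1 ^+ k) - 1).
Proof.
move=> k0 x0; pose v i := if P i then geom n (x ^+ i ^+ k) - 1 else 0.
rewrite (series_single_out (v := v)).
  rewrite -prod_few_copies // [X in _ = _ * X]big_mkcond; congr (_ * _).
  by apply: eq_bigr => j _; apply: eq_bigr => r _; rewrite other_part_few.
move=> i i0; rewrite /v /singled_part; case: ifP => Pi.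
  rewrite -local_factor_many ?nilpotent_exprX //.
  by apply: eq_bigr => r _; rewrite andbT.
rewrite mulr0 -[RHS](local_factor_const0 n (x ^+ i)).
by apply: eq_bigr => r _; rewrite !andbF.
Qed.

Lemma series_a n (A : comNzRingType) (x : A) k :
  (0 < k)%N -> x ^+ n.+1 = 0 ->
  series x (@single_out n (counted_part k) (few_copies k))
  = few_series n x k
    * \sum_(i < n | (k %| i.+1)%N)
        (geom n (x ^+ i.+1) - 1 - k%:R * (geom n (x ^+ i.+1 ^+ k) - 1)).
Proof.
move=> k0 x0.
pose v i := if (k %| i)%N
  then geom n (x ^+ i) - 1 - k%:R * (geom n (x ^+ i ^+ k) - 1) else 0.
rewrite (series_single_out (v := v)).
  by rewrite prod_few_copies // [X in _ = _ * X]big_mkcond.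
move=> i i0; rewrite /v /counted_part; case: ifP => ki.
  by rewrite -local_factor_copies ?nilpotent_exprX.
by rewrite mulr0 local_factor_const0.
Qed.

Lemma series_b0 n (A : comNzRingType) (x : A) k :
  (0 < k)%N -> x ^+ n.+1 = 0 ->
  series x (@single_out n (singled_part (fun i _ => k %| i)%N (fun _ r => k %| r)%N)
                          (other_part (fun i _ => k %| i)%N))
  = few_series n x k
    * \sum_(i < n | (k %| i.+1)%N) (geom n (x ^+ i.+1 ^+ k) - 1).
Proof.
move=> k0 x0; apply: (series_b (v := fun i => geom n (x ^+ i ^+ k) - 1)) => //.
by move=> i i0 _; rewrite local_factor_multiple ?nilpotent_exprX.
Qed.

Lemma series_b1 n (A : comNzRingType) (x : A) k :
  (0 < k)%N -> x ^+ n.+1 = 0 ->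
  series x (@single_out n (singled_part (fun i _ => k %| i)%N (fun _ r => ~~ (k %| r)%N))
                          (other_part (fun i _ => k %| i)%N))
  = few_series n x k
    * \sum_(i < n | (k %| i.+1)%N)
        (geom n (x ^+ i.+1) - 1 - (geom n (x ^+ i.+1 ^+ k) - 1)).
Proof.
move=> k0 x0.
apply: (series_b (v := fun i => geom n (x ^+ i) - 1 - (geom n (x ^+ i ^+ k) - 1))) => //.
move=> i i0 _; rewrite -(local_factor_multiple k0 (nilpotent_exprX i0 x0)).
rewrite -(local_factor_some n (x ^+ i)) -sumrB; apply: eq_bigr => r _.
by rewrite -mulrBl; case: (0 < r)%N; case: (k %| r)%N; rewrite /= ?subr0 ?subrr.
Qed.

(** * Comparison of the counts *)

(** The multiples of k are the k * i, and those beyond n contribute nothing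
    because [geom n 0 = 1]. *)
Lemma sum_dilated n (A : comNzRingType) (x : A) k :
  (0 < k)%N -> x ^+ n.+1 = 0 ->
  \sum_(i < n) (geom n (x ^+ i.+1 ^+ k) - 1)
  = \sum_(i < n | (k %| i.+1)%N) (geom n (x ^+ i.+1) - 1).
Proof.
move=> k0 x0; have F0 i : (n < i)%N -> geom n (x ^+ i) - 1 = 0.
  move=> ni; rewrite (nilpotent_expr x0 ni) /geom big_ord_recl expr0.
  rewrite big1 ?addr0 ?subrr // => r _.
  by rewrite exprS mul0r.
rewrite -(big_multiples +%R k0 F0).
by apply: eq_bigr => i _; rewrite -exprM mulnC.
Qed.

Lemma b0_c0 k n : (0 < k)%N -> b0 k n = c0 k n.
Proof.
move=> k0.
rewrite [LHS](card_exactly_one n (fun i _ => k %| i)%N (fun _ r => k %| r)%N).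
rewrite [RHS](card_exactly_one n (fun _ r => k <= r)%N (fun i _ => k %| i)%N).
apply: sum_partitions_eq => A x x0.
by rewrite series_b0 // (series_c (dvdn k)).
Qed.

(** The identity [sum_dilated] with the terms of index divisible by k on its
    left-hand side moved to the right. *)
Lemma b1_c1 k n : (0 < k)%N -> b1 k n = c1 k n.
Proof.
move=> k0.
rewrite [LHS](card_exactly_one n (fun i _ => k %| i)%N (fun _ r => ~~ (k %| r)%N)).
rewrite [RHS](card_exactly_one n (fun _ r => k <= r)%N (fun i _ => ~~ (k %| i)%N)).
apply: sum_partitions_eq => A x x0.
rewrite series_b1 // (series_c (fun i => ~~ (k %| i)%N)) //; congr (_ * _).
rewrite big_split /= -sum_dilated // sumrN.
by rewrite (bigID (fun i : 'I_n => (k %| i.+1)%N)) /= addrAC subrr add0r.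
Qed.

(** The subtraction-free form of the identity, so that it can be proved on
    natural-number weights. *)
Lemma a_b k n : (0 < k)%N -> (a k n + k * b0 k n = b1 k n + b0 k n)%N.
Proof.
move=> k0; rewrite a_single_out //.
rewrite [b0 k n](card_exactly_one n (fun i _ => k %| i)%N (fun _ r => k %| r)%N).
rewrite [b1 k n](card_exactly_one n (fun i _ => k %| i)%N (fun _ r => ~~ (k %| r)%N)).
rewrite -[X in (_ = _ + X)%N]mul1n !big_distrr -!big_split /=.
apply: sum_partitions_eq => A x x0.
rewrite !series_linear series_a // series_b0 // series_b1 // !mulrA ![_%:R * _]mulrC.
rewrite -!mulrA -!mulrDr; congr (_ * _); rewrite !mulr_sumr -!big_split /=.
by apply: eq_bigr => i _; ring.
Qed.

End GeneratingFunctions.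

Theorem theorem2p4 (n k : nat) (hk : 2 <= k) :
  (b0 k n = c0 k n /\ b1 k n = c1 k n) /\
  ((a k n)%:Z = (b1 k n)%:Z - (k%:Z - 1) * (b0 k n)%:Z /\
   (b1 k n)%:Z - (k%:Z - 1) * (b0 k n)%:Z
     = (c1 k n)%:Z - (k%:Z - 1) * (c0 k n)%:Z)%R.
Proof.
have k0 : 0 < k by apply: ltnW.
have e0 := b0_c0 n k0; have e1 := b1_c1 n k0.
have := a_b n k0; rewrite -e0 -e1 => e; split=> //; split=> //.
nia.
Qed.
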